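(* Let $P \subset \mathbb{R}^n$ be a convex lattice polytope. Both $\mathcal H(P;t)$ and $\mathrm{SE}(P;z)$ are invariant under lattice equivalence: if $Q \subset \mathbb{R}^n$ is a convex lattice polytope that is lattice equivalent to $P$, then $\mathcal H(Q;t) = \mathcal H(P;t)$ and $\mathrm{SE}(Q;z) = \mathrm{SE}(P;z)$.
   Context: A convex lattice polytope in $\mathbb{R}^n$ is the convex hull of a nonempty finite subset of $\mathbb{Z}^n$. Two convex lattice polytopes $P, Q \subset \mathbb{R}^n$ are lattice equivalent if $Q = \varphi(P)$ for some affine map $\varphi(x) = Ux + b$ with $U \in \mathrm{GL}_n(\mathbb{Z})$ and $b \in \mathbb{Z}^n$. A horizontal giganture of $P$ is a set of the form $iP + a$ with an integer $i \ge 0$ (the scale factor) and $a \in \mathbb{Z}^n$ (for $i=0$ it is the single point $a$). For an integer $t \ge 0$, $\mathcal H(P;t)$ is the number of horizontal gigantures of $P$ contained in $tP$, counted as pairs $(i,a)$ with $0 \le i \le t$, $a \in \mathbb{Z}^n$, $iP + a \subset tP$. (For $\dim P \ge 1$ this is simply the number of sets $iP+a$, $i \in \mathbb{Z}_{\ge 0}$, $a \in \mathbb{Z}^n$, contained in $tP$.) It is known that $\mathcal H(P;t)$ agrees for all integers $t\ge 0$ with a polynomial in $t$, also denoted $\mathcal H(P;t)$. Put $\mathrm{SE}(P;z) := \sum_{t=0}^\infty \mathcal H(P;t) z^t$. *)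

(* Defs.v *)
From HB Require Import structures.
From mathcomp Require Import all_boot all_order all_algebra.
From mathcomp Require Import finmap.
From mathcomp Require Import mathcomp_extra boolp classical_sets functions.
From mathcomp Require Import cardinality reals interval_inference convex.

Set Implicit Arguments.
Unset Strict Implicit.
Unset Printing Implicit Defensive.

Import Order.TTheory GRing.Theory Num.Theory.

Local Open Scope classical_set_scope.
Local Open Scope ring_scope.

Notation intmx R := (map_mx (intr : int -> R)).

Definition convex_hull (R : realType) (n : nat) (S : set 'cV[R]_n) :
    set 'cV[R]_n :=
  smallest (@convex_set R 'cV[R]_n) S.

Definition lattice_polytope (R : realType) (n : nat) (P : set 'cV[R]_n) :
    Prop :=
  exists V : set 'cV[int]_n,
    [/\ finite_set V, V !=set0 & P = convex_hull (intmx R @` V)].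

(* GL_n(Z) is the group of matrices that are invertible over int. *)
Definition lattice_equivalent (R : realType) (n : nat)
    (P Q : set 'cV[R]_n) : Prop :=
  exists2 U : 'M[int]_n, U \in unitmx &
  exists b : 'cV[int]_n,
    Q = [set intmx R U *m x + intmx R b | x in P].

Definition dilate (R : realType) (n : nat) (t : nat) (P : set 'cV[R]_n) :
    set 'cV[R]_n :=
  [set t%:R *: x | x in P].

Definition giganture (R : realType) (n : nat) (P : set 'cV[R]_n)
    (i : nat) (a : 'cV[int]_n) : set 'cV[R]_n :=
  [set x + intmx R a | x in dilate i P].

Definition gigantures_in (R : realType) (n : nat) (P : set 'cV[R]_n)
    (t : nat) : set (nat * 'cV[int]_n) :=
  [set ia | (ia.1 <= t)%N /\ giganture P ia.1 ia.2 `<=` dilate t P].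

(* Pairs (i, a) are counted, not the sets giganture P i a: these coincide for
   different pairs when P is a single point.
   fset_set sends an infinite set to fset0; gigantures_in_finite below shows
   that this case does not arise for lattice polytopes. *)
Definition giganture_count (R : realType) (n : nat) (P : set 'cV[R]_n)
    (t : nat) : nat :=
  #|` fset_set (gigantures_in P t)|.

Definition is_giganture_poly (R : realType) (n : nat) (P : set 'cV[R]_n)
    (h : {poly rat}) : Prop :=
  forall t : nat, h.[t%:R] = (giganture_count P t)%:R.

(* The formal power series \sum_t u_t z^t is given by its coefficients u. *)
Definition fps (A : Type) : Type := nat -> A.

Definition giganture_series (R : realType) (n : nat) (P : set 'cV[R]_n) :
    fps int :=
  fun t => (giganture_count P t)%:Z.

Lemma lattice_polytope_bounded (R : realType) (n : nat) (P : set 'cV[R]_n) :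
  lattice_polytope P ->
  exists N : nat, forall x, P x -> forall j, `|x j 0| <= N%:R.
Proof.
move=> [V [finV _ ->]].
pose N := \max_(v <- fset_set V) \max_j absz (v j ord0).
exists N => x /(_ [set y | forall j, `|y j 0| <= N%:R]); apply.
split.
  move=> /= y z l; rewrite !inE /= => yN zN j.
  have l0 : 0 <= l%:num :> R by [].
  have l1 : 0 <= 1 - l%:num :> R by rewrite subr_ge0.
  rewrite /conv /= !mxE.
  apply: (le_trans (ler_normD _ _)); rewrite !normrM !(ger0_norm l0).
  rewrite [X in _ + X * _](ger0_norm l1).
  have -> : N%:R = l%:num * N%:R + (1 - l%:num) * N%:R :> R.
    by rewrite -mulrDl addrC subrK mul1r.
  by rewrite lerD // ler_wpM2l.
move=> _ [v Vv <-] j; rewrite /= mxE -intr_norm -natr_absz ler_nat.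
have vV : v \in fset_set V by rewrite in_fset_set // inE.
have jN : (absz (v j ord0) <= \max_j absz (v j ord0))%N.
  exact: (leq_bigmax (F := fun j => absz (v j ord0))).
by apply: (leq_trans jN); apply: (leq_bigmax_seq
  (F := fun v : 'cV[int]_n => \max_j absz (v j ord0))).
Qed.

Lemma gigantures_in_finite (R : realType) (n : nat) (P : set 'cV[R]_n)
    (t : nat) :
  lattice_polytope P -> finite_set (gigantures_in P t).
Proof.
move=> polyP; have [N PN] := lattice_polytope_bounded polyP.
have [x Px] : P !=set0.
  case: polyP => V [_ [v Vv] ->]; exists (intmx R v).
  by move=> A [_]; apply; exists v.
pose M := (t * N + t * N)%N.
pose f (u : 'I_t.+1 * 'cV['I_(M + M).+1]_n) : nat * 'cV[int]_n :=
  (nat_of_ord u.1, \col_j ((u.2 j 0 : nat)%:Z - M%:Z)).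
apply: (sub_finite_set (B := f @` setT)); last first.
  exact/finite_image/finite_finset.
move=> [i a] [/= it sub].
have aM j : `|a j 0| <= M%:Z.
  have [y Py yE] : dilate t P (i%:R *: x + intmx R a).
    by apply: sub; exists (i%:R *: x) => //; exists x.
  have /(congr1 (fun z : 'cV[R]_n => z j 0)) := yE.
  rewrite !mxE => /(canLR (addKr _)) aE.
  rewrite -(ler_int R) intr_norm -aE -pmulrn natrD.
  apply: (le_trans (ler_normD _ _)); rewrite normrN !normrM !normr_nat !natrM.
  rewrite lerD ?ler_wpM2l ?ler0n ?PN //.
  by rewrite ler_pM ?PN // ler_nat.
exists (inord i, \col_j inord (absz (a j ord0 + M%:Z))) => //.
rewrite /f /= inordK //; congr pair; apply/colP => j; rewrite !mxE.
have /andP[aM1 aM2] : - M%:Z <= a j 0 <= M%:Z by rewrite -ler_norml.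
have ge0 : 0 <= a j 0 + M%:Z by rewrite -lerBlDr sub0r.
rewrite inordK; last by rewrite ltnS -lez_nat gez0_abs // PoszD lerD2r.
by rewrite gez0_abs // addrK.
Qed.

(* Main.v *)
Require Import Defs.
From mathcomp Require Import all_boot all_order all_algebra.
From mathcomp Require Import classical_sets reals.
From mathcomp Require Import finmap boolp functions cardinality.

(** A lattice equivalence [phi x = U x + b] from [P] to [Q] carries [t P] onto
    [t Q] through the rescaled map [phi_t x = U x + t b].  This map sends the
    giganture [i P + a] to [i Q + (U a + (t - i) b)], and
    [(i, a) |-> (i, U a + (t - i) b)] is a bijection. *)

Set Implicit Arguments.
Unset Strict Implicit.
Unset Printing Implicit Defensive.

Import Order.TTheory GRing.Theory Num.Theory.

Local Open Scope classical_set_scope.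
Local Open Scope ring_scope.

(** Kept general in the ring because it serves twice: over [R] for points, over [int] for
    translation vectors. *)
Lemma affine_mx_inj (R : comUnitRingType) (n : nat) (U : 'M[R]_n)
    (b : 'cV[R]_n) :
  U \in unitmx -> injective (fun x : 'cV[R]_n => U *m x + b).
Proof. by move=> unitU x y /addIr /(can_inj (mulKmx unitU)). Qed.

Lemma image_subset_inj (aT rT : Type) (f : aT -> rT) (A B : set aT) :
  injective f -> (f @` A `<=` f @` B) = (A `<=` B).
Proof.
move=> finj; rewrite propeqE; split=> [sub x Ax|]; last exact: image_subset.
by rewrite -(image_inj finj); apply: sub; exists x.
Qed.

(** The difference vanishes at 0, ..., [size (p - q) - 1], distinct in characteristic zero: too many
    roots for a nonzero polynomial. *)
Lemma polyP_nat (R : numDomainType) (p q : {poly R}) :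
  (forall t : nat, p.[t%:R] = q.[t%:R]) -> p = q.
Proof.
move=> pq; apply/eqP; rewrite -subr_eq0; apply/eqP.
pose rs : seq R := [seq t%:R | t <- iota 0 (size (p - q))].
apply: (@roots_geq_poly_eq0 _ _ rs).
- by apply/allP => _ /mapP[t _ ->]; rewrite rootE hornerD hornerN pq subrr.
- by rewrite map_inj_uniq ?iota_uniq //; exact: mulrIn (oner_neq0 R).
- by rewrite size_map size_iota.
Qed.

Section LatticeEquivalence.
Variables (R : realType) (n : nat) (P : set 'cV[R]_n).
Variables (U : 'M[int]_n) (b : 'cV[int]_n).
Hypothesis unitU : U \in unitmx.

Let Q := [set intmx R U *m x + intmx R b | x in P].

Definition affine_dilate (t : nat) (x : 'cV[R]_n) : 'cV[R]_n :=
  intmx R U *m x + t%:R *: intmx R b.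

(** The difference [t - i] is taken in [int], without truncation, so the identities below hold for
    [i > t] too. *)
Definition giganture_map (t : nat) (ia : nat * 'cV[int]_n) :
    nat * 'cV[int]_n :=
  (ia.1, U *m ia.2 + (t%:R - ia.1%:R) *: b).

Lemma affine_dilate_inj (t : nat) : injective (affine_dilate t).
Proof.
(* The determinant of [U] is a unit of [int], and ring morphisms preserve units. *)
by apply: affine_mx_inj; rewrite unitmxE det_map_mx rmorph_unit -?unitmxE.
Qed.

Lemma dilate_affine (t : nat) : dilate t Q = affine_dilate t @` dilate t P.
Proof.
rewrite /dilate /Q !image_comp; apply: eq_imagel => x _ /=.
by rewrite /affine_dilate scalerDr scalemxAr.
Qed.

(** Pointwise, [U (i x + a) + t b = (i U x + i b) + (U a + (t - i) b)]; the first bracket runs over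
    [i Q]. *)
Lemma giganture_affine (t : nat) (ia : nat * 'cV[int]_n) :
  giganture Q (giganture_map t ia).1 (giganture_map t ia).2 =
  affine_dilate t @` giganture P ia.1 ia.2.
Proof.
rewrite /giganture dilate_affine !image_comp; apply: eq_imagel => x _ /=.
rewrite /affine_dilate map_mxD map_mxM map_mxZ rmorphB /= !rmorph_nat.
by rewrite mulmxDr scalerBl addrACA [X in _ + X]addrC subrK.
Qed.

Lemma giganture_map_inj (t : nat) : injective (giganture_map t).
Proof.
by move=> [i a] [j c] [<-] /(affine_mx_inj unitU) ->.
Qed.

Lemma gigantures_in_map (t : nat) (ia : nat * 'cV[int]_n) :
  gigantures_in Q t (giganture_map t ia) = gigantures_in P t ia.
Proof.
rewrite /gigantures_in /mkset giganture_affine dilate_affine image_subset_inj //.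
exact: affine_dilate_inj.
Qed.

Lemma gigantures_in_affine (t : nat) :
  gigantures_in Q t = giganture_map t @` gigantures_in P t.
Proof.
apply/seteqP; split=> [[i a] Qia|_ [ia Pia <-]]; last by rewrite gigantures_in_map.
(* Solve [U c + (t - i) b = a] for [c]; the solution is integral since [U] is invertible over
   [int]. *)
have iaE : giganture_map t (i, invmx U *m (a - (t%:R - i%:R) *: b)) = (i, a).
  by rewrite /giganture_map /= mulKVmx // subrK.
exists (i, invmx U *m (a - (t%:R - i%:R) *: b)) => //.
by rewrite -gigantures_in_map iaE.
Qed.

Lemma giganture_count_affine (t : nat) :
  lattice_polytope P -> giganture_count Q t = giganture_count P t.
Proof.
move=> polyP; rewrite /giganture_count gigantures_in_affine.
(* [fset_set] commutes with the image because the set of pairs is finite, [P] being a lattice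
   polytope. *)
rewrite fset_set_image; last exact: gigantures_in_finite.
by rewrite card_imfset //; exact: giganture_map_inj.
Qed.

End LatticeEquivalence.

Theorem theorem8 (R : realType) (n : nat) (P Q : set 'cV[R]_n)
  (hP : lattice_polytope P) (hQ : lattice_polytope Q)
  (hPQ : lattice_equivalent P Q) :
  [/\ (forall t : nat, giganture_count Q t = giganture_count P t),
      (forall hp hq : {poly rat},
         is_giganture_poly P hp -> is_giganture_poly Q hq -> hq = hp)
    & giganture_series Q = giganture_series P].
Proof.
have countE t : giganture_count Q t = giganture_count P t.
  by case: hPQ => U unitU [b ->]; exact: giganture_count_affine.
split=> // [hp hq hpP hqQ|].
  by apply: polyP_nat => t; rewrite hpP hqQ countE.
by apply/funext => t; rewrite /giganture_series countE.
Qed.
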